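(* For an integer $n\ge 0$, let $G(n)$ denote the Grundy number of the Remove-a-Square game starting from a full $2$-by-$n$ rectangle. Then for every $n\ge 83$, $$G(n)=G(n-12).$$
   Context: Remove-a-Square game: a position is a finite set of unit cells of the square grid (the starting position is a shape made of such cells). Two players alternate moves. In a move, a player chooses a full $k$-by-$k$ square for some $k\ge 1$ (an axis-parallel $k$-by-$k$ block of grid cells, all of which are still present) and removes all its cells. The player without a move loses. For a $2$-by-$n$ rectangle, only $1$-by-$1$ and $2$-by-$2$ squares can be removed. The Grundy number of a position is defined recursively as $\operatorname{mex}(S)$, where $S$ is the set of Grundy numbers of all positions reachable in one move and $\operatorname{mex}(S)$ is the least non-negative integer not in $S$; in particular terminal positions have Grundy number $0$. *)

(* Defs.v *)
From mathcomp Require Import all_boot all_order all_algebra.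
From mathcomp Require Import finmap.

Set Implicit Arguments.
Unset Strict Implicit.
Unset Printing Implicit Defensive.

Local Open Scope fset_scope.

Definition cell : Type := (int * int)%type.

Definition position : Type := {fset cell}.

Definition rectangle (c : cell) (h w : nat) : position :=
  [fset ((c.1 + i%:Z)%R, (c.2 + j%:Z)%R) | i in iota 0 h, j in iota 0 w].

Definition square (c : cell) (k : nat) : position := rectangle c k k.

Definition move (P Q : position) : Prop :=
  exists (c : cell) (k : nat),
    [/\ 1 <= k, square c k `<=` P & Q = P `\` square c k].

(* A removable square has its least corner in P and side at most the number of
   cells of P, so this finite enumeration lists all moves (see optionsP). *)
Definition options (P : position) : {fset position} :=
  [fset P `\` square c k | c in P, k in iota 1 #|` P| & square c k `<=` P].

Lemma ex_notin (S : {fset nat}) : exists n : nat, n \notin S.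
Proof.
exists (\max_(i <- S) i).+1; apply/negP => mS.
by have := @leq_bigmax_seq nat (enum_fset S) xpredT id _ mS isT; rewrite ltnn.
Qed.

Definition mex (S : {fset nat}) : nat := ex_minn (ex_notin S).

(* The Grundy recursion unfolded to depth m. *)
Fixpoint grundy_rec (m : nat) (P : position) : nat :=
  if m is m'.+1 then mex [fset grundy_rec m' Q | Q in options P] else 0.

(* Each move removes at least one cell, so depth #|` P| + 1 suffices
   (see grundyE). *)
Definition grundy (P : position) : nat := grundy_rec #|` P|.+1 P.

Lemma mem_rectangle (c d : cell) (h w : nat) :
  reflect (exists i j : nat,
             [/\ i < h, j < w & d = ((c.1 + i%:Z)%R, (c.2 + j%:Z)%R)])
          (d \in rectangle c h w).
Proof.
apply: (iffP (imfset2P _ _ _ _ _)).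
  move=> [i]; rewrite [X in is_true X](mem_iota 0 h) => ih.
  by move=> [j]; rewrite [X in is_true X](mem_iota 0 w) => jw ->; exists i, j.
move=> [i [j [ih jw ->]]]; exists i; first by rewrite /= mem_iota.
by exists j; rewrite //= mem_iota.
Qed.

Lemma corner_square (c : cell) (k : nat) : 1 <= k -> c \in square c k.
Proof.
move=> k1; apply/mem_rectangle; exists 0, 0; split=> //.
by rewrite !GRing.addr0; case: c.
Qed.

Lemma leq_card_square (c : cell) (k : nat) : k <= #|` square c k|.
Proof.
case: k => [|k] //.
pose f (j : nat) : cell := (c.1, (c.2 + j%:Z)%R).
have injf : injective f by move=> i j [] /GRing.addrI [].
rewrite -[X in X <= _](size_iota 0) -(size_map f).
apply: uniq_leq_size; first by rewrite map_inj_uniq ?iota_uniq.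
move=> d /mapP[j]; rewrite mem_iota add0n => /= jk ->.
by apply/mem_rectangle; exists 0, j; split=> //; rewrite GRing.addr0.
Qed.

Lemma optionsP (P Q : position) : reflect (move P Q) (Q \in options P).
Proof.
apply: (iffP (imfset2P _ _ _ _ _)) => /=.
  case=> c _ [k]; rewrite inE /= mem_iota => /andP[/andP[k1 _] sP] ->.
  by exists c, k.
case=> c [k [k1 sP ->]]; exists c.
  exact: (fsubsetP sP _ (corner_square c k1)).
exists k => //; rewrite inE /= mem_iota k1 add1n ltnS sP andbT.
exact: leq_trans (leq_card_square c k) (fsubset_leq_card sP).
Qed.

Lemma move_card (P Q : position) : move P Q -> #|` Q| < #|` P|.
Proof.
case=> c [k [k1 sP ->]]; rewrite cardfsDS //.
have sq0 := leq_trans k1 (leq_card_square c k).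
by rewrite ltn_subrL sq0 (leq_trans sq0 (fsubset_leq_card sP)).
Qed.

Lemma grundy_rec_stable (m n : nat) (P : position) :
  #|` P| < m -> #|` P| < n -> grundy_rec m P = grundy_rec n P.
Proof.
elim: m n P => [//|m IH] [//|n] P; rewrite !ltnS => Pm Pn /=.
congr mex; apply: eq_in_imfset => //= Q /optionsP/move_card QP.
by apply: IH; apply: leq_trans QP _.
Qed.

Lemma grundyE (P : position) :
  grundy P = mex [fset grundy Q | Q in options P].
Proof.
rewrite {1}/grundy /=; congr mex; apply: eq_in_imfset => //= Q.
by move=> /optionsP/move_card QP; exact: grundy_rec_stable.
Qed.

Definition G (n : nat) : nat := grundy (rectangle (0%R, 0%R) 2 n).

(* Main.v *)
Require Import Defs.
From mathcomp Require Import all_boot.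
From Stdlib Require Import PeanoNat.
From mathcomp Require Import all_algebra zify finmap.

Set Implicit Arguments.
Unset Strict Implicit.
Unset Printing Implicit Defensive.

Local Open Scope fset_scope.
Local Open Scope nat_scope.

(** The game on a 2-by-n strip behaves like a splitting game on heaps.  Taking
    a single cell out of a full strip ruins its column: the other cell of that
    column can now only be taken alone, and no 2-by-2 square crosses the column.
    So the position falls apart into two shorter full strips, of total length
    n - 1, and one loose cell.  Taking a 2-by-2 square leaves two full strips
    of total length n - 2.

    A move inside one of several pieces that no square can straddle leaves the
    other pieces alone, so Grundy numbers of such pieces combine by bitwise
    exclusive or (Sprague-Grundy, [grundy_union]).  A loose cell has Grundy
    number 1, whence the recursion [G_rec]: G(n) is the mex of all
    G(a) xor G(b) xor 1 with a + b = n - 1 and all G(a) xor G(b) with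
    a + b = n - 2.

    A sequence that obeys this recursion is periodic as soon as the period is
    seen on a long enough window ([strip_periodic]).  When a + b is large, one
    of a, b is already in the periodic range, and moving it by one period
    turns the options of n into those of n - p and back.  With p = 12 the
    period starts at 83, and the window 83..166 is checked by evaluating the
    recursion ([G_periodic_base]). *)

(** * Bitwise exclusive or as a sum of heaps *)

(** Flipping the bits of [c] in [a] lowers [a] when the top bit of [c] is set
    in [a]: the bits above it are unchanged and it becomes 0. *)
Lemma lxor_ltn (a c : nat) :
  c != 0 -> Nat.testbit a (Nat.log2 c) -> Nat.lxor a c < a.
Proof.
move=> c0; set d := Nat.log2 c => ad.
(* Shifting by d leaves only the top bit of c, and it makes that bit of a
   the parity bit. *)
have c1 : Nat.shiftr c d = 1.
  rewrite Nat.shiftr_div_pow2; symmetry.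
  have [|lo hi] := Nat.log2_spec c; first by lia.
  apply: (Nat.div_unique _ _ _ (c - 2 ^ d)%coq_nat);
    rewrite -/d /= in lo hi *; lia.
have odd_a : Nat.odd (Nat.shiftr a d) by rewrite -Nat.bit0_odd Nat.shiftr_spec'.
have: Nat.lxor (Nat.shiftr a d) 1 < Nat.shiftr a d.
  case/Nat.odd_spec: odd_a => q ->.
  have -> : Nat.lxor (2 * q + 1)%coq_nat 1 = (2 * q)%coq_nat.
    apply: Nat.bits_inj => -[|i]; rewrite Nat.lxor_spec.
      by rewrite Nat.testbit_odd_0 Nat.testbit_even_0.
    by rewrite Nat.testbit_odd_succ' Nat.testbit_even_succ'
       (Nat.bits_0 i : Nat.testbit 1 i.+1 = _) Bool.xorb_false_r.
  by lia.
rewrite -c1 -Nat.shiftr_lxor !Nat.shiftr_div_pow2 => lt_div.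
rewrite ltnNge; apply/negP => /leP le_a.
have := Nat.Div0.div_le_mono _ _ (2 ^ d)%coq_nat le_a; lia.
Qed.

Lemma lxorK (a b : nat) : Nat.lxor (Nat.lxor a b) b = a.
Proof. by rewrite Nat.lxor_assoc Nat.lxor_nilpotent Nat.lxor_0_r. Qed.

Lemma lxorKl (a b : nat) : Nat.lxor a (Nat.lxor a b) = b.
Proof. by rewrite -Nat.lxor_assoc Nat.lxor_nilpotent Nat.lxor_0_l. Qed.

(** The winning strategy of Nim on two heaps: to lower the xor to [t], look at
    the top bit in which it differs from [t].  That bit is set in the xor, hence
    in one of the heaps, and this heap can absorb the whole difference. *)
Lemma lxor_excludent (a b t : nat) : t < Nat.lxor a b ->
  (exists2 a', a' < a & Nat.lxor a' b = t) \/
  (exists2 b', b' < b & Nat.lxor a b' = t).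
Proof.
set s := Nat.lxor a b => lt_ts; pose c := Nat.lxor s t.
have c0 : c != 0 by apply/eqP => /Nat.lxor_eq st; rewrite st ltnn in lt_ts.
have sc : Nat.lxor s c = t by exact: lxorKl.
have tc : Nat.lxor t c = s by rewrite Nat.lxor_comm lxorK.
have s_top : Nat.testbit s (Nat.log2 c).
  apply: contraT => /negbTE s_top.
  have: Nat.testbit c (Nat.log2 c) by apply: Nat.bit_log2; apply/eqP.
  rewrite {1}/c Nat.lxor_spec s_top => /(lxor_ltn c0).
  by rewrite tc ltnNge ltnW.
move: s_top; rewrite /s Nat.lxor_spec.
case a_top: (Nat.testbit a _) => /= b_top.
- left; exists (Nat.lxor a c); first exact: lxor_ltn.
  by rewrite -sc /s (Nat.lxor_assoc a c) (Nat.lxor_assoc a b) (Nat.lxor_comm c).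
- right; exists (Nat.lxor b c); first exact: lxor_ltn.
  by rewrite -sc /s (Nat.lxor_assoc a b).
Qed.

(** * Grundy numbers characterised by moves *)

Lemma mex_notin (S : {fset nat}) : mex S \notin S.
Proof. by rewrite /mex; case: ex_minnP. Qed.

Lemma mem_lt_mex (S : {fset nat}) (k : nat) : k < mex S -> k \in S.
Proof.
rewrite /mex; case: ex_minnP => m _ min_m.
by apply: contraTT => /min_m; rewrite -leqNgt.
Qed.

Lemma mex_unique (S : {fset nat}) (m : nat) :
  m \notin S -> (forall k, k < m -> k \in S) -> mex S = m.
Proof.
move=> mS ltS; case: (ltngtP (mex S) m) => // [/ltS|/mem_lt_mex].
  by rewrite (negPf (mex_notin S)).
by rewrite (negPf mS).
Qed.

Lemma grundy_move_neq (P Q : position) : move P Q -> grundy Q <> grundy P.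
Proof.
move=> /optionsP PQ eqPQ; have := mex_notin [fset grundy Q' | Q' in options P].
by rewrite -grundyE -eqPQ => /negP; apply; apply: in_imfset.
Qed.

Lemma grundy_reach (P : position) (t : nat) :
  t < grundy P -> exists2 Q, move P Q & grundy Q = t.
Proof.
rewrite grundyE => /mem_lt_mex/imfsetP[Q /= /optionsP PQ ->].
by exists Q.
Qed.

Lemma grundy_unique (P : position) (m : nat) :
    (forall Q, move P Q -> grundy Q <> m) ->
    (forall t, t < m -> exists2 Q, move P Q & grundy Q = t) ->
  grundy P = m.
Proof.
move=> neq_m reach; rewrite grundyE; apply: mex_unique.
  by apply/negP => /imfsetP[Q /= /optionsP/neq_m neqQ /esym].
move=> t /reach[Q /optionsP PQ <-]; exact: in_imfset.
Qed.

(** * Sums of independent positions *)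

(** Two pieces form a sum of games when no square straddles them.  Quantifying
    over all squares that fit in the union, and not only over the current moves
    of some larger game, makes the notion hereditary ([independentS]), so it
    survives every move. *)
Definition independent (A B : position) : Prop :=
  [disjoint A & B] /\
  forall c k, square c k `<=` A `|` B -> square c k `<=` A \/ square c k `<=` B.

Lemma independentC (A B : position) : independent A B -> independent B A.
Proof.
case=> dAB sq; split=> [|c k]; first by rewrite fdisjoint_sym.
by rewrite fsetUC => /sq[]; [right | left].
Qed.

Lemma independentS (A A' B : position) :
  A' `<=` A -> independent A B -> independent A' B.
Proof.
move=> sA [dAB sq]; split=> [|c k sqU]; first exact: fdisjointWl dAB.
case: (sq c k (fsubset_trans sqU (fsetSU _ sA))) => [sqA|]; last by right.
left; apply/fsubsetP => d dsq; have := fsubsetP sqU d dsq.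
rewrite inE => /orP[//|dB].
by have /fdisjointP/(_ d (fsubsetP sqA d dsq)) := dAB; rewrite dB.
Qed.

Lemma move_unionl (A A' B : position) :
  [disjoint A & B] -> move A A' -> move (A `|` B) (A' `|` B).
Proof.
move=> dAB [c [k [k1 sA ->]]]; exists c, k; split=> //.
  exact: fsubset_trans sA (fsubsetUl _ _).
rewrite fsetDUl; congr (_ `|` _); apply/esym/fsetDidPl.
by rewrite fdisjoint_sym; apply: fdisjointWl dAB.
Qed.

Lemma move_union (A B Q : position) : independent A B -> move (A `|` B) Q ->
  (exists2 A', move A A' & Q = A' `|` B) \/
  (exists2 B', move B B' & Q = A `|` B').
Proof.
move=> [dAB sq] [c [k [k1 /sq[sA|sB] ->]]]; [left | right].
- exists (A `\` square c k); first by exists c, k.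
  rewrite fsetDUl; congr (_ `|` _); apply/fsetDidPl.
  by rewrite fdisjoint_sym; apply: fdisjointWl dAB.
- exists (B `\` square c k); first by exists c, k.
  rewrite fsetDUl; congr (_ `|` _); apply/fsetDidPl.
  exact: fdisjointWr dAB.
Qed.

Lemma move_subset (P Q : position) : move P Q -> Q `<=` P.
Proof. by case=> c [k [_ _ ->]]; exact: fsubsetDl. Qed.

(** The Sprague-Grundy theorem: a move in one piece changes its Grundy number,
    so it changes the xor, and [lxor_excludent] says that every smaller xor is
    within reach of a move that lowers one of the two numbers. *)
Lemma grundy_union (A B : position) : independent A B ->
  grundy (A `|` B) = Nat.lxor (grundy A) (grundy B).
Proof.
have [m] := ubnP (#|` A| + #|` B|); elim: m A B => // m IH A B lt_m indAB.
have IHl A' : move A A' -> grundy (A' `|` B) = Nat.lxor (grundy A') (grundy B).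
  move=> AA'; apply: IH; last exact: independentS (move_subset AA') indAB.
  by have := move_card AA'; lia.
have IHr B' : move B B' -> grundy (A `|` B') = Nat.lxor (grundy A) (grundy B').
  move=> BB'; apply: IH; first by have := move_card BB'; lia.
  apply: independentC.
  exact: independentS (move_subset BB') (independentC indAB).
apply: grundy_unique => [Q /(move_union indAB)[] [X mX ->]|t /lxor_excludent[]].
- rewrite IHl // => eqX; apply: (grundy_move_neq mX).
  by rewrite -(lxorK (grundy X) (grundy B)) eqX lxorK.
- rewrite IHr // => eqX; apply: (grundy_move_neq mX).
  by rewrite -(lxorKl (grundy A) (grundy X)) eqX lxorKl.
- case=> _ /grundy_reach[A' AA' <-] <-; exists (A' `|` B); last exact: IHl.
  exact: move_unionl indAB.1 AA'.
- case=> _ /grundy_reach[B' BB' <-] <-; exists (A `|` B'); last exact: IHr.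
  rewrite fsetUC (fsetUC A); apply: move_unionl BB'.
  by case/independentC: indAB.
Qed.

(** * Pieces of a strip *)

(** Membership by inequalities turns geometric side conditions into linear
    arithmetic. *)
Lemma in_rectangle (x y u v : int) (h w : nat) :
  ((u, v) \in rectangle (x, y) h w) =
  [&& x <= u, u < x + h%:Z, y <= v & v < y + w%:Z]%R.
Proof.
apply/mem_rectangle/idP => /= [[i [j [ih jw [-> ->]]]]|]; first by lia.
move=> in_uv; exists (absz (u - x)), (absz (v - y)); split; try lia.
by congr pair; lia.
Qed.

Lemma square1 (e : cell) : square e 1 = [fset e].
Proof.
case: e => x y; apply/fsetP => -[u v].
by rewrite in_rectangle inE xpair_eqE; lia.
Qed.

(** A square that meets both sides of column [y] has a cell in that column,
    because its columns form an interval, but neither piece has one. *)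
Lemma independent_columns (A B : position) (y : int) :
    (forall c, c \in A -> c.2 < y)%R -> (forall c, c \in B -> y < c.2)%R ->
  independent A B.
Proof.
move=> ltA ltB; split.
  by apply/fdisjointP => c /ltA cA; apply/negP => /ltB; lia.
move=> [u v] k sqU.
have inU p q : (u <= p < u + k%:Z)%R -> (v <= q < v + k%:Z)%R ->
    (p, q) \in A `|` B.
  by move=> hp hq; apply: (fsubsetP sqU); rewrite in_rectangle; lia.
have [vy|vy] : (v < y)%R \/ (y <= v)%R by lia.
  left; apply/fsubsetP => -[p q] pq.
  have:= fsubsetP sqU _ pq; rewrite inE => /orP[//|/ltB /= yq].
  move: pq; rewrite in_rectangle => pq.
  have: (u, y) \in A `|` B by apply: inU; lia.
  by rewrite inE => /orP[/ltA|/ltB] /=; lia.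
right; apply/fsubsetP => -[p q] pq.
have:= fsubsetP sqU _ pq; rewrite inE => /orP[/ltA /= qy|//].
by move: pq; rewrite in_rectangle; lia.
Qed.

(** A square of side at least 2 through [e] contains a second cell of the
    column of [e]. *)
Lemma independent_cell (A : position) (e : cell) :
  (forall c, c \in A -> c.2 <> e.2) -> independent A (square e 1).
Proof.
case: e => x y /= colA.
have in1 p q : ((p, q) \in square (x, y) 1) = (p == x) && (q == y).
  by rewrite square1 inE xpair_eqE.
split; first by apply/fdisjointP => -[p q] /colA /= qy; rewrite in1; lia.
move=> [u v] k sqU.
have inU p q : (u <= p < u + k%:Z)%R -> (v <= q < v + k%:Z)%R ->
    (p, q) \in A `|` square (x, y) 1.
  by move=> hp hq; apply: (fsubsetP sqU); rewrite in_rectangle; lia.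
have [e_sq|e_sq] := boolP ((x, y) \in square (u, v) k); last first.
  left; apply/fsubsetP => -[p q] pq.
  have := fsubsetP sqU _ pq; rewrite inE in1 => /orP[//|/andP[/eqP px /eqP qy]].
  by rewrite px qy (negPf e_sq) in pq.
(* For k >= 2 the cells of the square in column y and in its two first rows
   would both be e. *)
right; move: e_sq; rewrite in_rectangle => e_sq.
have [k1|k2] : k = 1 \/ 2 <= k by lia.
  by apply/fsubsetP => -[p q]; rewrite k1 in1 in_rectangle; lia.
have: (u, y) \in A `|` square (x, y) 1 by apply: inU; lia.
have: (u + 1, y)%R \in A `|` square (x, y) 1 by apply: inU; lia.
by rewrite !inE !in1 => /orP[/colA //|h1] /orP[/colA //|h2]; lia.
Qed.

Lemma grundy_fset0 : grundy fset0 = 0.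
Proof.
apply: grundy_unique => // Q [c [k [k1 /fsubsetP/(_ c (corner_square c k1))]]].
by rewrite inE.
Qed.

Lemma grundy_cell (e : cell) : grundy (square e 1) = 1.
Proof.
have mv0 : move (square e 1) fset0 by exists e, 1; rewrite fsetDv fsubset_refl.
apply: grundy_unique => [Q eQ|[|//] _]; last first.
  by exists fset0 => //; exact: grundy_fset0.
suff -> : Q = fset0 by rewrite grundy_fset0.
apply/eqP; rewrite -cardfs_eq0 -leqn0 -ltnS (leq_trans (move_card eQ)) //.
by rewrite square1 cardfs1.
Qed.

(** * The recursion for full strips *)

(** The values reached from a strip of length [n] if [f] gives the values of
    shorter strips; the summand 1 is the loose cell.  The second range has
    length [n.-1] so that it is empty for [n <= 1]. *)
Definition strip_options (f : nat -> nat) (n : nat) : seq nat :=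
  [seq Nat.lxor (Nat.lxor (f a) (f (n.-1 - a))) 1 | a <- iota 0 n] ++
  [seq Nat.lxor (f a) (f (n.-2 - a)) | a <- iota 0 n.-1].

Lemma strip_optionsP (f : nat -> nat) (n x : nat) :
  reflect (exists a b : nat,
             (a + b + 1 = n /\ x = Nat.lxor (Nat.lxor (f a) (f b)) 1) \/
             (a + b + 2 = n /\ x = Nat.lxor (f a) (f b)))
          (x \in strip_options f n).
Proof.
rewrite mem_cat; apply: (iffP orP).
  case=> /mapP[a]; rewrite mem_iota => an ->.
    by exists a, (n.-1 - a); left; split=> //; lia.
  by exists a, (n.-2 - a); right; split=> //; lia.
case=> a [b [] [<- ->]]; [left | right].
  apply/mapP; exists a; first by rewrite mem_iota; lia.
  by congr (Nat.lxor (Nat.lxor _ (f _)) _); lia.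
apply/mapP; exists a; first by rewrite mem_iota; lia.
by congr (Nat.lxor _ (f _)); lia.
Qed.

Lemma remove_cell (x y : int) (i a b : nat) : i < 2 ->
  rectangle (x, y) 2 (a + b + 1) `\` square (x + i%:Z, y + a%:Z)%R 1 =
  (rectangle (x, y) 2 a `|` rectangle (x, y + a%:Z + 1)%R 2 b)
    `|` square (x + 1 - i%:Z, y + a%:Z)%R 1.
Proof.
by move=> i2; apply/fsetP => -[p q]; rewrite !inE /square !in_rectangle; lia.
Qed.

Lemma remove_2x2 (x y : int) (a b : nat) :
  rectangle (x, y) 2 (a + b + 2) `\` square (x, y + a%:Z)%R 2 =
  rectangle (x, y) 2 a `|` rectangle (x, y + a%:Z + 2)%R 2 b.
Proof. by apply/fsetP => -[p q]; rewrite !inE /square !in_rectangle; lia. Qed.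

Lemma independent_strips (x y z : int) (a b : nat) : (y + a%:Z < z)%R ->
  independent (rectangle (x, y) 2 a) (rectangle (x, z) 2 b).
Proof.
move=> yz; apply: (@independent_columns _ _ (y + a%:Z)%R) => -[p q];
  by rewrite in_rectangle /=; lia.
Qed.

(** A square inside the strip has side 1 or 2, and side 2 forces it to use both
    rows; [a] is the number of columns to its left and [b] to its right. *)
Lemma strip_moves (x y : int) (n : nat) (Q : position) :
  move (rectangle (x, y) 2 n) Q <->
  exists a b : nat,
    (a + b + 1 = n /\ exists2 i, i < 2 &
       Q = (rectangle (x, y) 2 a `|` rectangle (x, y + a%:Z + 1)%R 2 b)
             `|` square (x + 1 - i%:Z, y + a%:Z)%R 1) \/
    (a + b + 2 = n /\
       Q = rectangle (x, y) 2 a `|` rectangle (x, y + a%:Z + 2)%R 2 b).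
Proof.
split=> [[[u v] [k [k1 sq ->]]]|[a [b [[<- [i i2 ->]]|[<- ->]]]]]; last first.
- exists (x, y + a%:Z)%R, 2; split=> //; last by rewrite remove_2x2.
  by apply/fsubsetP => -[p q]; rewrite !in_rectangle; lia.
- exists (x + i%:Z, y + a%:Z)%R, 1; split=> //; last by rewrite remove_cell.
  by apply/fsubsetP => -[p q]; rewrite !in_rectangle; lia.
have lo : (u, v) \in rectangle (x, y) 2 n.
  by apply: (fsubsetP sq); rewrite in_rectangle; lia.
(* The opposite corner bounds the side k by 2. *)
have hi : (u + k%:Z - 1, v + k%:Z - 1)%R \in rectangle (x, y) 2 n.
  by apply: (fsubsetP sq); rewrite in_rectangle; lia.
rewrite !in_rectangle in lo hi.
have [a va] : exists a : nat, v = (y + a%:Z)%R by exists (absz (v - y)); lia.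
have [k_eq|k_eq] : k = 1 \/ k = 2 by lia.
  have [i ui] : exists i : nat, u = (x + i%:Z)%R by exists (absz (u - x)); lia.
  have n_eq : n = a + (n - a - 1) + 1 by lia.
  exists a, (n - a - 1); left; split=> //; exists i; first by lia.
  by rewrite k_eq ui va {1}n_eq remove_cell //; lia.
have n_eq : n = a + (n - a - 2) + 2 by lia.
have ux : u = x by lia.
exists a, (n - a - 2); right; split=> //.
by rewrite k_eq ux va {1}n_eq remove_2x2.
Qed.

(** The hypothesis covers shorter strips at every place in the grid, because
    the right-hand piece of a split strip starts at a new column.  Induction
    over all corners at once replaces a proof of translation invariance. *)
Lemma grundy_strip_mex (f : nat -> nat) (n : nat) (c : cell) :
    (forall m d, m < n -> grundy (rectangle d 2 m) = f m) ->
  grundy (rectangle c 2 n) = mex [fset t in strip_options f n].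
Proof.
case: c => x y fE; rewrite grundyE; congr mex; apply/fsetP => t.
have val1 a b i : a + b + 1 = n ->
    grundy ((rectangle (x, y) 2 a `|` rectangle (x, y + a%:Z + 1)%R 2 b)
             `|` square (x + 1 - i%:Z, y + a%:Z)%R 1) =
    Nat.lxor (Nat.lxor (f a) (f b)) 1.
  move=> abn; rewrite grundy_union; last first.
    apply: independent_cell => -[p q] /=.
    by rewrite inE !in_rectangle; lia.
  rewrite grundy_union; last by apply: independent_strips; lia.
  by rewrite grundy_cell !fE //; lia.
have val2 a b : a + b + 2 = n ->
    grundy (rectangle (x, y) 2 a `|` rectangle (x, y + a%:Z + 2)%R 2 b) =
    Nat.lxor (f a) (f b).
  move=> abn; rewrite grundy_union; last by apply: independent_strips; lia.
  by rewrite !fE //; lia.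
rewrite [RHS]in_fset.
apply/imfsetP/strip_optionsP => [[Q /= /optionsP/strip_moves]|].
  by case=> a [b [[abn [i _ ->]]|[abn ->]]] ->; exists a, b; [left | right];
    rewrite ?val1 ?val2.
case=> a [b [] [abn ->]].
- exists ((rectangle (x, y) 2 a `|` rectangle (x, y + a%:Z + 1)%R 2 b)
             `|` square (x + 1 - 0%:Z, y + a%:Z)%R 1); last by rewrite val1.
  by apply/optionsP/strip_moves; exists a, b; left; split=> //; exists 0.
- exists (rectangle (x, y) 2 a `|` rectangle (x, y + a%:Z + 2)%R 2 b).
    by apply/optionsP/strip_moves; exists a, b; right.
  by rewrite val2.
Qed.

Lemma grundy_strip (n : nat) (c : cell) : grundy (rectangle c 2 n) = G n.
Proof.
elim/ltn_ind: n c => n IH c.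
have IH' m d : m < n -> grundy (rectangle d 2 m) = G m by move=> /IH.
by rewrite /G !(grundy_strip_mex _ IH').
Qed.

Lemma G_rec (n : nat) : G n = mex [fset t in strip_options G n].
Proof. by apply: grundy_strip_mex => m d _; exact: grundy_strip. Qed.

(** * Periodicity *)

(** The window reaches [2 * n0] since for [n > 2 * n0] a decomposition
    [a + b >= n - 2 >= 2 * n0 - 1] has a part that is at least [n0], which can
    be shortened by [p]; conversely, in a decomposition
    [a + b >= n - p - 2] of the shorter strip, [a] and [b] cannot both be below
    [n0 - p], and a part that is at least [n0 - p] can be lengthened. *)
Lemma strip_periodic (f : nat -> nat) (p n0 : nat) :
    (forall n, f n = mex [fset t in strip_options f n]) -> p <= n0 ->
    (forall n, n0 <= n <= 2 * n0 -> f n = f (n - p)) ->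
  forall n, n0 <= n -> f n = f (n - p).
Proof.
move=> fE p_le base; elim/ltn_ind => n IH n0n.
have [n_le|n_gt] := leqP n (2 * n0); first by apply: base; rewrite n0n.
have up a : n0 <= a + p -> a + p < n -> f a = f (a + p).
  by move=> h1 h2; rewrite [RHS]IH // addnK.
rewrite fE [RHS]fE; congr mex; apply/fsetP => t; rewrite !in_fset.
apply/strip_optionsP/strip_optionsP => -[a [b]].
- have [n0a|a_lt] := leqP n0 a; move=> abn.
    exists (a - p), b.
    have <- : f a = f (a - p) by apply: IH => //; lia.
    lia.
  exists a, (b - p).
  have <- : f b = f (b - p) by apply: IH; lia.
  lia.
- have [n0a|a_lt] := leqP n0 (a + p); move=> abn.
    exists (a + p), b.
    have <- : f a = f (a + p) by apply: up; lia.
    lia.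
  exists a, (b + p).
  have <- : f b = f (b + p) by apply: up; lia.
  lia.
Qed.

(** A version of mex that evaluates; by counting, some number up to the length
    of the list is missing from it. *)
Definition mex_seq (s : seq nat) : nat :=
  find (fun k => k \notin s) (iota 0 (size s).+1).

Lemma mex_seqE (s : seq nat) : mex [fset t in s] = mex_seq s.
Proof.
have has_gap : has (fun k => k \notin s) (iota 0 (size s).+1).
  rewrite -[has _ _]negbK -all_predC; apply/negP => /allP sub_s.
  have: size (iota 0 (size s).+1) <= size s.
    apply: uniq_leq_size (iota_uniq _ _) _ => k /sub_s /=.
    by rewrite negbK.
  by rewrite size_iota ltnn.
have lt_mex : mex_seq s < (size s).+1.
  by rewrite -[X in _ < X](size_iota 0) -has_find.
apply: mex_unique => [|k lt_k]; rewrite !inE.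
  by have := nth_find 0 has_gap; rewrite nth_iota.
have := before_find 0 lt_k; rewrite nth_iota; last exact: ltn_trans lt_k lt_mex.
by move/negbFE.
Qed.

(** Memoising the earlier values keeps the evaluation of the recursion
    polynomial. *)
Fixpoint strip_table (n : nat) : seq nat :=
  if n is m.+1 then
    let s := strip_table m in rcons s (mex_seq (strip_options (nth 0 s) m))
  else [::].

Lemma strip_tableE (n : nat) : strip_table n = mkseq G n.
Proof.
elim: n => [//|n IH] /=; rewrite IH mkseqS; congr rcons.
rewrite G_rec -mex_seqE; congr mex; apply/fsetP => t; rewrite !in_fset.
by apply/strip_optionsP/strip_optionsP => -[a [b h]]; exists a, b;
  move: h; case=> -[abn ->]; [left|right|left|right]; split=> //;
  rewrite !nth_mkseq //; lia.
Qed.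

Lemma G_periodic_base (n : nat) : 83 <= n <= 2 * 83 -> G n = G (n - 12).
Proof.
move=> n_bd.
have tab k : k < 167 -> G k = nth 0 (strip_table 167) k.
  by move=> k_lt; rewrite strip_tableE nth_mkseq.
rewrite !tab; try lia.
have /allP/(_ n) : let s := strip_table 167 in
    all (fun k => nth 0 s k == nth 0 s (k - 12)) (iota 83 84) by vm_compute.
by rewrite mem_iota => /(_ n_bd)/eqP.
Qed.

Theorem theorem7 (n : nat) : 83 <= n -> G n = G (n - 12).
Proof.
exact: (strip_periodic (p := 12) (n0 := 83) G_rec isT G_periodic_base).
Qed.
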